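(* The aggregation method GSC satisfies Weak Proportional Representation (Weak-PR), while the aggregation method GS fails Weak-PR. Here an aggregation method $\mathcal{R}$ satisfies Weak-PR if for each budgeting scenario $E=(P,V,c,L)$ with $n=|V|$, each $\ell\in\{1,\dots,L\}$, each set $V'\subseteq V$ of voters with $|V'|\ge \ell n/L$, and each set $P'\subseteq P$ of projects with $c(P')\le\ell$, there exists a budgeting scenario $E'$ which differs from $E$ only in the votes of the voters from $V'$, such that $P'\subseteq\mathcal{R}(E')$.
   Context: A budgeting scenario is a tuple $E=(P,V,c,L)$: a finite set of projects $P$; each project $p$ has a cost $c(p)\in\{1,2,\dots\}$; a finite nonempty set of voters $V=\{v_1,\dots,v_n\}$, where voter $v_j$ casts a cumulative ballot, i.e. values $v_j(p)\ge 0$ with $\sum_{p\in P}v_j(p)=1$; and a budget limit $L\in\{1,2,\dots\}$. For $B\subseteq P$, $c(B)=\sum_{p\in B}c(p)$. An aggregation method $\mathcal{R}$ maps each scenario $E$ to a bundle $\mathcal{R}(E)\subseteq P$ with $c(\mathcal{R}(E))\le L$. The greedy rule based on a priority function $f:P\to\mathbb{R}$ ranks the projects in descending order of $f$ (ties are resolved by an arbitrary fixed tie-breaking rule) and goes through this ranking; the considered project is selected if its cost does not exceed the remaining budget (initially $L$), in which case the remaining budget decreases by its cost; otherwise it is skipped. GS (Greedy-by-Support) is the greedy rule based on $f_{\mathrm{GS}}(p)=\sum_{j=1}^n v_j(p)$. GSC (Greedy-by-Support-over-Cost) is the greedy rule based on $f_{\mathrm{GSC}}(p)=\frac{1}{c(p)}\sum_{j=1}^n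 v_j(p)\cdot\frac{L}{n}$. *)

(* Defs.v *)
From HB Require Import structures.
From mathcomp Require Import all_boot all_order all_algebra.
From mathcomp Require Import reals.

Set Implicit Arguments.
Unset Strict Implicit.
Unset Printing Implicit Defensive.

Import Order.TTheory GRing.Theory Num.Theory.

Local Open Scope ring_scope.

Record scenario (R : realType) (P V : finType) := Scenario {
  cost : P -> nat;
  limit : nat;
  ballot : V -> P -> R;
  cost_gt0 : forall p, (0 < cost p)%N;
  limit_gt0 : (0 < limit)%N;
  voters_gt0 : (0 < #|V|)%N;
  ballot_ge0 : forall v p, 0 <= ballot v p;
  ballot_sum1 : forall v, \sum_(p : P) ballot v p = 1
}.

Definition bundle_cost (R : realType) (P V : finType) (E : scenario R P V)
  (B : {set P}) : nat := (\sum_(p in B) cost E p)%N.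

Record aggregation_method (R : realType) := AggregationMethod {
  select :> forall P V : finType, scenario R P V -> {set P};
  select_feasible : forall (P V : finType) (E : scenario R P V),
    (bundle_cost E (select E) <= limit E)%N
}.

(* A tie-breaking rule assigns to each scenario a linear order on its projects;
   [tie_le t E p q] means that [p] is ranked before [q] when their priorities
   are equal.  The order may depend on the scenario (e.g. cheaper projects
   first); a fixed order on each project set is the constant case. *)
Record tie_breaking (R : realType) := TieBreaking {
  tie_le : forall P V : finType, scenario R P V -> rel P;
  tie_le_total : forall (P V : finType) (E : scenario R P V),
    total (tie_le E);
  tie_le_anti : forall (P V : finType) (E : scenario R P V),
    antisymmetric (tie_le E);
  tie_le_trans : forall (P V : finType) (E : scenario R P V),
    transitive (tie_le E)
}.

Definition priority_function (R : realType) :=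
  forall P V : finType, scenario R P V -> P -> R.

Definition ranking (R : realType) (t : tie_breaking R)
  (f : priority_function R) (P V : finType) (E : scenario R P V) : seq P :=
  sort (fun p q => (f P V E q < f P V E p)
                || ((f P V E p == f P V E q) && tie_le t E p q)) (enum P).

(* [b] is the remaining budget. *)
Fixpoint greedy_pass (P : finType) (c : P -> nat) (b : nat) (s : seq P)
  : {set P} :=
  if s is p :: s' then
    if (c p <= b)%N then p |: greedy_pass c (b - c p)%N s'
    else greedy_pass c b s'
  else set0.

Lemma greedy_pass_feasible (P : finType) (c : P -> nat) (b : nat) (s : seq P) :
  (\sum_(p in greedy_pass c b s) c p <= b)%N.
Proof.
elim: s b => [|p s IHs] b /=; first by rewrite big_set0.
case: ifP => // le_pb; have [p_in|p_notin] := boolP (p \in greedy_pass c (b - c p) s).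
  by rewrite (setUidPr _) ?sub1set //; apply: leq_trans (IHs _) (leq_subr _ _).
by rewrite big_setU1 //= -leq_subRL // IHs.
Qed.

Definition greedy_rule (R : realType) (t : tie_breaking R)
  (f : priority_function R) : aggregation_method R :=
  @AggregationMethod R
    (fun P V E => greedy_pass (cost E) (limit E) (ranking t f E))
    (fun P V E => greedy_pass_feasible (cost E) (limit E) (ranking t f E)).

Definition f_GS (R : realType) : priority_function R :=
  fun P V E p => \sum_(v : V) ballot E v p.

Definition f_GSC (R : realType) : priority_function R :=
  fun P V E p =>
    1 / (cost E p)%:R *
    \sum_(v : V) (ballot E v p * ((limit E)%:R / #|V|%:R)).

Definition GS (R : realType) (t : tie_breaking R) : aggregation_method R :=
  greedy_rule t (@f_GS R).

Definition GSC (R : realType) (t : tie_breaking R) : aggregation_method R :=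
  greedy_rule t (@f_GSC R).

Definition differ_only_in_votes_of (R : realType) (P V : finType)
  (V' : {set V}) (E E' : scenario R P V) : Prop :=
  [/\ cost E' =1 cost E,
      limit E' = limit E &
      forall v, v \notin V' -> ballot E' v =1 ballot E v].

Definition weak_PR (R : realType) (M : aggregation_method R) : Prop :=
  forall (P V : finType) (E : scenario R P V) (l : nat)
         (V' : {set V}) (P' : {set P}),
    (1 <= l <= limit E)%N ->
    l%:R * #|V|%:R / (limit E)%:R <= #|V'|%:R :> R ->
    (bundle_cost E P' <= l)%N ->
    exists2 E' : scenario R P V,
      differ_only_in_votes_of V' E E' & P' \subset M P V E'.

(* Main.v *)
(** Under GSC the voters of V' split their votes over P' in proportion to the
    costs.  This gives every project of P' a priority of at least
    (l / L) * L / c(P') >= 1, whereas the cost-weighted priorities of all projects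
    add up to exactly L.  A skipped project p of P' would come with a set of
    projects (p and the ones selected before it) of total cost above L, all of
    priority at least 1, hence of cost-weighted priority above L.

    GS fails with L = n = 3, a project [true] of cost 3 receiving all votes
    and a project [false] of cost 1: a single voter cannot prevent [true] from
    being first and exhausting the budget, although l = 1 entitles her to
    [false]. *)

Require Import Defs.
From mathcomp Require Import all_boot all_order all_algebra.
From mathcomp Require Import reals.

Set Implicit Arguments.
Unset Strict Implicit.
Unset Printing Implicit Defensive.

Import Order.TTheory GRing.Theory Num.Theory.

Local Open Scope ring_scope.

(** [B] consists of [p] and the projects selected before it: [p] is skipped exactly because its cost
    exceeds what they leave of [b]. *)
Lemma greedy_pass_skipped (P : finType) (c : P -> nat) (e : rel P) (b : nat)
    (s : seq P) (p : P) :
  reflexive e -> uniq s -> pairwise e s ->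
  p \in s -> p \notin greedy_pass c b s ->
  exists B : {set P},
    [/\ {subset B <= s}, {in B, forall q, e q p}
      & (b < \sum_(q in B) c q)%N].
Proof.
move=> e_refl; elim: s b => //= x s IHs b /andP[xs us] /andP[/allP ex es].
rewrite inE => /predU1P[->|ps].
  case: ifP => [_|]; first by rewrite setU11.
  move=> /negbT; rewrite -ltnNge => cb _; exists [set x].
  split=> [q /set1P->|q /set1P->|]; rewrite ?mem_head ?e_refl //.
  by rewrite big_set1.
case: ifP => [cb|_].
  rewrite in_setU1 => /norP[_ /(IHs _ us es ps)[B [Bs Be Bb]]].
  (* Here [x] was selected, so [B] overruns only [b - c x]; adding [x] restores its cost, and
     [uniq s] keeps it out of [B]. *)
  exists (x |: B); split=> [q|q|].
  - by rewrite in_setU1 inE => /predU1P[->|/Bs->]; rewrite ?eqxx ?orbT.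
  - by rewrite in_setU1 => /predU1P[->|/Be//]; apply: ex.
  - rewrite big_setU1 /=; last by apply: contra xs => /Bs.
    by rewrite -ltn_subLR.
move=> /(IHs _ us es ps)[B [Bs Be Bb]]; exists B; split=> // q /Bs qs.
by rewrite inE qs orbT.
Qed.

Section Greedy.
Variables (R : realType) (t : tie_breaking R) (f : priority_function R).
Variables (P V : finType) (E : scenario R P V).

(** The sorting relation is total and refines weakly descending priority; transitivity of the latter
    passes from neighbours to all pairs. *)
Lemma ranking_pairwise : pairwise (fun p q => f E q <= f E p) (ranking t f E).
Proof.
have ge_trans : transitive (fun p q => f E q <= f E p).
  by move=> y x z /= xy yz; apply: le_trans xy.
rewrite -(sorted_pairwise ge_trans).
apply: (sub_sorted _ (sort_sorted _ _)).
  by move=> p q /orP[/ltW//|/andP[/eqP-> _]].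
move=> p q /=; case: (ltgtP (f E p) (f E q)) => //= _.
exact: tie_le_total.
Qed.

Lemma greedy_rule_skipped (p : P) :
  p \notin greedy_rule t f P V E ->
  exists B : {set P},
    {in B, forall q, f E p <= f E q} /\ (limit E < bundle_cost E B)%N.
Proof.
move=> pN.
have [q|||B [_ fB cB]] := greedy_pass_skipped _ _ ranking_pairwise _ pN.
- exact: lexx.
- by rewrite sort_uniq enum_uniq.
- by rewrite mem_sort mem_enum.
- by exists B.
Qed.

End Greedy.

Section GreedyBySupportOverCost.
Variables (R : realType) (P V : finType) (E : scenario R P V).

Lemma cost_f_GSC (p : P) :
  (cost E p)%:R * f_GSC E p =
  (\sum_(v : V) ballot E v p) * ((limit E)%:R / #|V|%:R).
Proof.
rewrite /f_GSC mul1r mulrA mulfV ?mul1r ?mulr_suml //.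
by rewrite pnatr_eq0 -lt0n cost_gt0.
Qed.

Lemma f_GSC_ge0 (p : P) : 0 <= f_GSC E p.
Proof.
rewrite mulr_ge0 ?divr_ge0 ?ler0n ?ler01 // sumr_ge0 // => v _.
by rewrite mulr_ge0 ?divr_ge0 ?ler0n ?ballot_ge0.
Qed.

(** Each voter distributes a total vote of 1, worth [L / n], and there are [n] voters. *)
Lemma sum_cost_f_GSC : \sum_(p : P) (cost E p)%:R * f_GSC E p = (limit E)%:R.
Proof.
under eq_bigr do rewrite cost_f_GSC.
rewrite -mulr_suml exchange_big /=.
under eq_bigr do rewrite ballot_sum1.
rewrite sumr_const mulrC divfK //.
by rewrite pnatr_eq0 -lt0n (voters_gt0 E).
Qed.

Lemma GSC_select (t : tie_breaking R) (p : P) :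
  1 <= f_GSC E p -> p \in GSC t P V E.
Proof.
move=> fp; apply: contraT => /greedy_rule_skipped[B [fB]].
apply: contraTT => _; rewrite -leqNgt -(ler_nat R) -sum_cost_f_GSC.
(* The total is split into [B] and the rest: on [B] priorities are at least 1, so cost is at most
   cost-weighted priority; the rest is nonnegative. *)
rewrite /bundle_cost natr_sum [leRHS](bigID (mem B)) /= -[leLHS]addr0.
apply: lerD.
  apply: ler_sum => q qB; rewrite ler_peMr ?ler0n //.
  exact: le_trans fp (fB q qB).
by apply: sumr_ge0 => q _; rewrite mulr_ge0 ?ler0n ?f_GSC_ge0.
Qed.

End GreedyBySupportOverCost.

Section ProportionalVotes.
Variables (R : realType) (P V : finType) (E : scenario R P V).
Variables (V' : {set V}) (P' : {set P}).
Hypothesis P'_gt0 : (0 < bundle_cost E P')%N.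

Definition proportional_ballot (v : V) (p : P) : R :=
  if v \in V' then
    if p \in P' then (cost E p)%:R / (bundle_cost E P')%:R else 0
  else ballot E v p.

Lemma proportional_ballot_ge0 v p : 0 <= proportional_ballot v p.
Proof.
rewrite /proportional_ballot; case: ifP => _; last exact: ballot_ge0.
by case: ifP; rewrite ?divr_ge0 ?ler0n.
Qed.

Lemma proportional_ballot_sum1 v : \sum_(p : P) proportional_ballot v p = 1.
Proof.
rewrite /proportional_ballot; case: (v \in V'); last exact: ballot_sum1.
rewrite -big_mkcond -mulr_suml -natr_sum mulfV //.
by rewrite pnatr_eq0 -lt0n.
Qed.

Definition proportional_scenario : scenario R P V :=
  Scenario (cost_gt0 E) (limit_gt0 E) (voters_gt0 E)
    proportional_ballot_ge0 proportional_ballot_sum1.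

Lemma f_GSC_proportional_scenario (l : nat) (p : P) :
  l%:R * #|V|%:R / (limit E)%:R <= #|V'|%:R :> R ->
  (bundle_cost E P' <= l)%N -> p \in P' ->
  1 <= f_GSC proportional_scenario p.
Proof.
move=> lV P'l pP'.
have cp : 0 < (cost E p)%:R :> R by rewrite ltr0n cost_gt0.
have L_gt0 : 0 < (limit E)%:R :> R by rewrite ltr0n limit_gt0.
have n_gt0 : 0 < #|V|%:R :> R by rewrite ltr0n (voters_gt0 E).
have cP' : 0 < (bundle_cost E P')%:R :> R by rewrite ltr0n.
rewrite -(ler_pM2l cp) mulr1 (cost_f_GSC proportional_scenario p) /=.
(* Only the votes from [V'] are counted; the other voters add a nonnegative amount. *)
have support : (cost E p)%:R / (bundle_cost E P')%:R * #|V'|%:R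
    <= \sum_(v : V) proportional_ballot v p.
  rewrite (bigID (mem V')) /= -[leLHS]addr0; apply: lerD.
    rewrite mulr_natr -sumr_const; apply: ler_sum => v vV'.
    by rewrite /proportional_ballot vV' pP'.
  by apply: sumr_ge0 => v _; apply: proportional_ballot_ge0.
apply: le_trans (ler_wpM2r _ support); last by rewrite divr_ge0 ?ltW.
(* Cancelling the cost of [p] leaves [c(P') <= |V'| * L / n], which is shown through [l]. *)
rewrite -!mulrA ler_pMr // mulrC ler_pdivlMr // mul1r.
apply: (@le_trans _ _ l%:R); first by rewrite ler_nat.
by rewrite mulrA ler_pdivlMr // -ler_pdivrMr.
Qed.

End ProportionalVotes.

Lemma GSC_weak_PR (R : realType) (t : tie_breaking R) : weak_PR (GSC t).
Proof.
move=> P V E l V' P' _ lV P'l.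
(* An empty [P'] is treated apart, since the proportional ballot divides by [c(P')]. *)
have [->|[p0 p0P']] := set_0Vmem P'; first by exists E; rewrite ?sub0set.
have P'_gt0 : (0 < bundle_cost E P')%N.
  by rewrite /bundle_cost (bigD1 p0) //= addn_gt0 cost_gt0.
exists (proportional_scenario V' P'_gt0).
  split=> // v /negPf vV' p /=; rewrite /proportional_ballot vV' //.
apply/subsetP => p pP'; apply: GSC_select.
exact: f_GSC_proportional_scenario lV P'l pP'.
Qed.

Section GreedyBySupportCounterexample.
Variable R : realType.

Definition unanimous_cost (p : bool) : nat := if p then 3 else 1.

Definition unanimous_ballot (v : 'I_3) (p : bool) : R := p%:R.

Lemma unanimous_cost_gt0 p : (0 < unanimous_cost p)%N.
Proof. by case: p. Qed.

Lemma card_I3_gt0 : (0 < #|'I_3|)%N.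
Proof. by rewrite card_ord. Qed.

Lemma unanimous_ballot_ge0 v p : 0 <= unanimous_ballot v p.
Proof. exact: ler0n. Qed.

Lemma unanimous_ballot_sum1 v : \sum_(p : bool) unanimous_ballot v p = 1.
Proof. by rewrite big_bool /= addr0. Qed.

Definition unanimous_scenario : scenario R bool 'I_3 :=
  Scenario unanimous_cost_gt0 (isT : 0 < 3)%N card_I3_gt0
    unanimous_ballot_ge0 unanimous_ballot_sum1.

(** Voter [ord0] can give [false] at most 1, while the two others still give [true] a support of
    2. *)
Lemma f_GS_one_deviation (E : scenario R bool 'I_3) :
  differ_only_in_votes_of [set ord0] unanimous_scenario E ->
  f_GS E false < f_GS E true.
Proof.
move=> [_ _ same]; have sameE v : v != ord0 -> ballot E v =1 unanimous_ballot v.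
  by move=> v0; apply: same; rewrite inE.
have b0 := ballot_sum1 E ord0; rewrite big_bool /= in b0.
have ge0 := ballot_ge0 E ord0 true.
rewrite /f_GS !big_ord_recl !big_ord0 !(sameE (lift _ _)) //.
rewrite /unanimous_ballot /= !addr0.
apply: (@le_lt_trans _ _ 1); first by rewrite -b0 lerDr.
by rewrite (lt_le_trans (ltr1n R 2)) // lerDr.
Qed.

Lemma GS_not_weak_PR (t : tie_breaking R) : ~ weak_PR (GS t).
Proof.
move=> /(_ bool 'I_3 unanimous_scenario 1 [set ord0] [set false])[] //.
- by rewrite cards1 card_ord mul1r divff ?pnatr_eq0.
- by rewrite /bundle_cost big_set1.
move=> E dE; have lt_f := f_GS_one_deviation dE.
(* With the projects listed, the rule computes: [lt_f] ranks [true] first, its cost 3 uses up the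
   limit, and [false] no longer fits. *)
have enum_boolE : enum {: bool} = [:: true; false]
  by rewrite enumT unlock.
case: dE => cE lE _; rewrite sub1set /= /ranking enum_boolE /sort /= lt_f /=.
by rewrite !cE lE /= in_setU1 in_set0.
Qed.

End GreedyBySupportCounterexample.

Theorem theorem4 (R : realType) (t : tie_breaking R) :
  weak_PR (GSC t) /\ ~ weak_PR (GS t).
Proof. by split; [apply: GSC_weak_PR | apply: GS_not_weak_PR]. Qed.
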